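(* Let $n \geq 2$. Suppose that $\mathbf{w}_1, \ldots, \mathbf{w}_j \in \mathbb{Q}^{m^n}$ are sum-zero weighting vectors such that, for each $k \in \{1,\ldots,n\}$, their projections $\mathrm{Proj}_k(\mathbf{w}_1), \ldots, \mathrm{Proj}_k(\mathbf{w}_j)$ onto $S^{((n-k),(k),\emptyset,\ldots,\emptyset)}$ are linearly independent. If $\mathbf{r}_1,\ldots,\mathbf{r}_j \in R$ are any results vectors each of whose entries sum to zero, then there exist infinitely many profiles $\mathbf{p} \in P$ such that $T_{\mathbf{w}_i}(\mathbf{p}) = \mathbf{r}_i$ for all $1 \leq i \leq j$.
   Context: Let $m\ge 2$, $n\ge 1$ and $j \geq 1$ be integers and $[n]=\{1,\dots,n\}$. There are $n$ departments, each with $m$ candidates; $i_k$ denotes candidate $k\in[m]$ from department $i\in[n]$. A committee is a tuple $(1_{k_1},2_{k_2},\ldots,n_{k_n})$ with $k_1,\ldots,k_n\in[m]$; there are $m^n$ committees. A full ranking is a total ordering of all $m^n$ committees from most to least preferred; there are $(m^n)!$ full rankings. The profile space $P$ is the $\mathbb{Q}$-vector space with basis the set of full rankings; its elements (rational-valued functions on the set of full rankings) are called profiles. The results space $R$ is the $\mathbb{Q}$-vector space with basis the set of committees; its elements are called results vectors. A weighting vector is a vector $\mathbf{w}=[w_1,\ldots,w_{m^n}]^t\in\mathbb{Q}^{m^n}$; it is sum-zero if its entries sum to $0$. The positional voting map $T_{\mathbf{w}}:P\to R$ is the linear map sending a full ranking $F$ to the results vector whose entry at each committee $\mathbf{c}$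 is $w_s$, where $s$ is the position of $\mathbf{c}$ in $F$ (position 1 being first place). A weighting vector $\mathbf{w}$ is identified with an element of $R$ by listing the committees in lexicographic order of $(k_1,\ldots,k_n)$: the entry of $\mathbf{w}$ at the $s$-th committee in this order is $w_s$. The wreath product $S_m\wr S_n$ is the set of pairs $(\sigma;\pi)$ with $\sigma=(\sigma_1,\ldots,\sigma_n)\in S_m^n$, $\pi\in S_n$, with the group law for which $(\sigma;\pi)\, i_k=\pi(i)_{\sigma_{\pi(i)}(k)}$ defines a left action on candidates, i.e. $(\sigma;\pi)(\sigma';\pi')=(\tau;\pi\pi')$ with $\tau_i=\sigma_i\sigma'_{\pi^{-1}(i)}$. It acts on committees by $(\sigma;\pi)(1_{k_1},\ldots,n_{k_n})=(1_{\sigma_1(k_{\pi^{-1}(1)})},\ldots,n_{\sigma_n(k_{\pi^{-1}(n)})})$, which makes $R$ a $\mathbb{Q}S_m\wr S_n$-module. For a partition $\mu$ of $m$, $S^\mu$ denotes the simple $\mathbb{Q}S_m$-module (Specht module) indexed by $\mu$. For $0\le k\le n$, $S^{((n-k),(k),\emptyset,\ldots,\emptyset)}$ denotes the simple $\mathbb{Q}S_m\wr S_n$-module obtained as follows: let $Y=S_{n-k}\times S_k\le S_n$; the $\mathbb{Q}S_m^n$-module $(S^{(m)})^{\otimes (n-k)}\otimes (S^{(m-1,1)})^{\otimes k}$ extends to a module over $S_m\wr Y=\{(\sigma;\pi):\pi\in Y\}$ via $(\sigma;\pi)(v_1\otimes\cdots\otimes v_n)=\sigma_1v_{\pi^{-1}(1)}\otimes\cdots\otimes\sigma_nv_{\pi^{-1}(n)}$;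 induce this module from $S_m\wr Y$ to $S_m\wr S_n$. For $k\in[n]$, $\mathrm{Proj}_k$ denotes the module projection of $R$ onto its submodule corresponding to $S^{((n-k),(k),\emptyset,\ldots,\emptyset)}$, i.e. onto the isotypic component of $R$ of that type (the sum of all submodules of $R$ isomorphic to it), along the sum of the other isotypic components. *)

(* Defs.v *)
From HB Require Import structures.
From mathcomp Require Import all_boot all_order all_fingroup all_algebra.
From mathcomp Require Import mathcomp_extra boolp classical_sets functions cardinality.
Set Implicit Arguments.
Unset Strict Implicit.
Unset Printing Implicit Defensive.
Import GroupScope GRing.Theory.
Local Open Scope ring_scope.

Section Span.
Variable V : vectType rat.
Implicit Types (A : set V) (U : {vspace V}).

Definition span_set A : {vspace V} :=
  xget 0%VS [set U | forall v, v \in U <->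
    exists s : seq V, (forall x, x \in s -> A x) /\ v \in <<s>>%VS]%classic.

Lemma mem_span_set A v : v \in span_set A <->
  exists s : seq V, (forall x, x \in s -> A x) /\ v \in <<s>>%VS.
Proof.
rewrite /span_set; set P0 := (X in xget _ X).
suff exU : exists U, P0 U by exact: (xgetPex 0%VS exU v).
pose P d := `[< exists2 s : seq V, forall x, x \in s -> A x & \dim <<s>> = d >].
have exP : exists d, P d by exists (\dim <<[::] : seq V>>); apply/asboolP; exists [::].
have bP d : P d -> (d <= \dim {:V})%N.
  by move=> /asboolP[s _ <-]; apply/dimvS/subvf.
case: (ex_maxnP exP bP) => d /asboolP[s sA ds] dmax.
exists <<s>>%VS => {}v; split=> [vs|[t [tA vt]]]; first by exists s.
have st : (<<s>> <= <<s ++ t>>)%VS by apply: sub_span => x xs; rewrite mem_cat xs.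
have tt : (<<t>> <= <<s ++ t>>)%VS.
  by apply: sub_span => x xs; rewrite mem_cat xs orbT.
have /eqP-> : <<s>>%VS == <<s ++ t>>%VS; last exact: (subvP tt).
rewrite eqEdim st ds; apply: dmax; apply/asboolP; exists (s ++ t) => // x.
by rewrite mem_cat => /orP[/sA|/tA].
Qed.

Lemma span_set_sub A v : A v -> v \in span_set A.
Proof.
move=> Av; apply/mem_span_set; exists [:: v].
by split=> [x|]; rewrite ?memv_span1 // inE => /eqP->.
Qed.

Lemma span_set_min A U : (forall v, A v -> v \in U) -> (span_set A <= U)%VS.
Proof.
move=> AU; apply/subvP => v /mem_span_set[s [sA]]; apply/subvP/span_subvP => x.
by move/sA/AU.
Qed.

Lemma span_set_id A : A 0 -> (forall a u v, A u -> A v -> A (a *: u + v)) ->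
  forall v, v \in span_set A <-> A v.
Proof.
move=> A0 AD v; split=> [/mem_span_set[s [sA]]|]; last exact: span_set_sub.
elim: s v sA => [|x s IHs] v sA; first by rewrite span_nil memv0 => /eqP->.
rewrite span_cons => /memv_addP[u /vlineP[a ->]] [w ws ->].
apply: AD; first by apply: sA; rewrite mem_head.
by apply: IHs => // y ys; apply: sA; rewrite in_cons ys orbT.
Qed.

End Span.

Record gmodule (gT : finGroupType) := GModule {
  gm_space :> vectType rat;
  gm_act : gT -> gm_space -> gm_space;
  gm_linear : forall g, linear (gm_act g);
  gm_act1 : forall v, gm_act 1%g v = v;
  gm_actM : forall g h v, gm_act (g * h)%g v = gm_act g (gm_act h v) }.

Lemma gm_act0 (gT : finGroupType) (M : gmodule gT) (g : gT) :
  gm_act g (0 : M) = 0.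
Proof.
by have := gm_linear g (-1) (0 : M) 0; rewrite !scaleN1r oppr0 add0r addNr.
Qed.

Section GModules.
Variable gT : finGroupType.

Definition mod_iso (M N : gmodule gT) : Prop :=
  exists f : 'Hom(M, N), bijective f /\
    forall g v, f (gm_act g v) = gm_act g (f v).

Section Submodule.
Variable M : gmodule gT.

Definition submodule (U : {vspace M}) : Prop :=
  forall g u, u \in U -> gm_act g u \in U.

Variables (U : {vspace M}) (hU : submodule U).

Definition submod_act (g : gT) (u : subvs_of U) : subvs_of U :=
  Subvs (hU g (subvsP u)).

Fact submod_linear g : linear (submod_act g).
Proof. by move=> a u v; apply: val_inj; rewrite /= gm_linear. Qed.

Fact submod_act1 u : submod_act 1%g u = u.
Proof. by apply: val_inj; rewrite /= gm_act1. Qed.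

Fact submod_actM g h u : submod_act (g * h)%g u = submod_act g (submod_act h u).
Proof. by apply: val_inj; rewrite /= gm_actM. Qed.

Definition submod : gmodule gT := GModule submod_linear submod_act1 submod_actM.

End Submodule.

Definition simple_mod (M : gmodule gT) : Prop :=
  (exists v : M, v != 0) /\
  forall U : {vspace M}, submodule U -> U = 0%VS \/ U = fullv.

Section Isotypic.
Variables M S : gmodule gT.

Definition isotypic : {vspace M} :=
  span_set [set v | exists U (hU : @submodule M U),
    mod_iso (submod hU) S /\ v \in U]%classic.

End Isotypic.

Definition other_isotypic (M S : gmodule gT) : {vspace M} :=
  span_set [set v | exists S' : gmodule gT,
    [/\ simple_mod S', ~ mod_iso S' S & v \in isotypic M S']]%classic.

(** By Maschke's theorem the two subspaces are complementary in [M] as soon as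
    [S] is simple. *)
Definition isotypic_proj (M S : gmodule gT) : 'End(M) :=
  daddv_pi (isotypic M S) (other_isotypic M S).

(** The permutation module on a left [gT]-set [X]: functions on [X], the
    indicator function of [x] standing for the basis vector [x]. *)
Section PermutationModule.
Variables (X : finType) (a : gT -> X -> X).
Hypotheses (a1 : forall x, a 1%g x = x)
           (aM : forall g h x, a (g * h)%g x = a g (a h x)).

Definition perm_act (g : gT) (f : {ffun X -> rat^o}) : {ffun X -> rat^o} :=
  [ffun x => f (a g^-1%g x)].

Fact perm_linear g : linear (perm_act g).
Proof. by move=> c u v; apply/ffunP => x; rewrite !ffunE. Qed.

Fact perm_act1 f : perm_act 1%g f = f.
Proof. by apply/ffunP => x; rewrite !ffunE invg1 a1. Qed.

Fact perm_actM g h f : perm_act (g * h)%g f = perm_act g (perm_act h f).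
Proof. by apply/ffunP => x; rewrite !ffunE invMg aM. Qed.

Definition perm_mod : gmodule gT := GModule perm_linear perm_act1 perm_actM.

End PermutationModule.

Section RestrictionInduction.
Variable H : {group gT}.

Section Restriction.
Variable M : gmodule gT.

Fact res_linear (h : subg_of H) : linear (@gm_act _ M (sgval h)).
Proof. exact: gm_linear. Qed.

Fact res_act1 v : @gm_act _ M (sgval (1%g : subg_of H)) v = v.
Proof. exact: gm_act1. Qed.

Fact res_actM (g h : subg_of H) v :
  @gm_act _ M (sgval (g * h)%g) v = gm_act (sgval g) (gm_act (sgval h) v).
Proof. exact: gm_actM. Qed.

Definition res_mod : gmodule (subg_of H) := GModule res_linear res_act1 res_actM.

End Restriction.

(** Induction, realised as the functions [f : gT -> N] with
    [f (g * h) = h^-1 (f g)] for [h] in [H], on which [x] acts by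
    [(x f) g = f (x^-1 * g)]; [g (x) v] in [Q gT (x)_(Q H) N] is the function
    supported on [g *: H] sending [g * h] to [h^-1 v]. *)
Section Induction.
Variable N : gmodule (subg_of H).

Definition ind_fun (f : {ffun gT -> N}) : Prop :=
  forall (g : gT) (h : subg_of H),
    f (g * sgval h)%g = gm_act h^-1%g (f g).

Definition ind_space : {vspace {ffun gT -> N}} :=
  span_set [set f | ind_fun f]%classic.

Lemma mem_ind_space f : f \in ind_space <-> ind_fun f.
Proof.
apply: (@span_set_id _ [set f | ind_fun f]%classic) => [g h|c u v iu iv g h].
  by rewrite !ffunE gm_act0.
by rewrite !ffunE iu iv gm_linear.
Qed.

Definition ind_shift (x : gT) (f : {ffun gT -> N}) : {ffun gT -> N} :=
  [ffun g => f (x^-1 * g)%g].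

Fact ind_shift_in x f : f \in ind_space -> ind_shift x f \in ind_space.
Proof.
by move=> /mem_ind_space fi; apply/mem_ind_space => g h; rewrite !ffunE mulgA fi.
Qed.

Definition ind_act (x : gT) (f : subvs_of ind_space) : subvs_of ind_space :=
  Subvs (ind_shift_in x (subvsP f)).

Fact ind_linear x : linear (ind_act x).
Proof. by move=> c u v; apply/val_inj/ffunP => g; rewrite /= !ffunE. Qed.

Fact ind_act1 f : ind_act 1%g f = f.
Proof. by apply/val_inj/ffunP => g; rewrite /= !ffunE invg1 mul1g. Qed.

Fact ind_actM x y f : ind_act (x * y)%g f = ind_act x (ind_act y f).
Proof. by apply/val_inj/ffunP => g; rewrite /= !ffunE invMg mulgA. Qed.

Definition ind_mod : gmodule gT := GModule ind_linear ind_act1 ind_actM.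

End Induction.
End RestrictionInduction.
End GModules.

Section Specht.
Variable m : nat.

(** A tabloid is encoded by the function sending an entry to the index of its
    row. All functions ['I_m -> 'I_m] are allowed; the tabloids of a given
    shape [mu] are among them, so [M^mu] sits in the functions on [tabloid]. *)
Definition tabloid : finType := {ffun 'I_m -> 'I_m}.

Definition tabloid_act (s : {perm 'I_m}) (T : tabloid) : tabloid :=
  [ffun x => T (s^-1%g x)].

(** A tableau sends an entry to the (row, column) of its cell; [mu] is a
    partition of [m] given by its parts, so that an injection of ['I_m] into
    the cells of [mu] is a bijection. *)
Definition tableau (mu : seq nat) (t : {ffun 'I_m -> 'I_m * 'I_m}) : bool :=
  injectiveb t && [forall x, ((t x).2 < nth 0%N mu (t x).1)%N].

Definition row_tabloid (t : {ffun 'I_m -> 'I_m * 'I_m}) : tabloid :=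
  [ffun x => (t x).1].

Definition column_stabiliser (t : {ffun 'I_m -> 'I_m * 'I_m}) : pred {perm 'I_m} :=
  [pred s : {perm 'I_m} | [forall x, (t (s x)).2 == (t x).2]].

Definition polytabloid (t : {ffun 'I_m -> 'I_m * 'I_m}) : {ffun tabloid -> rat^o} :=
  [ffun T => \sum_(s | column_stabiliser t s)
               (-1) ^+ s * (tabloid_act s (row_tabloid t) == T)%:R].

Definition specht (mu : seq nat) : {vspace {ffun tabloid -> rat^o}} :=
  <<[seq polytabloid t | t <- enum (tableau mu)]>>%VS.

Lemma tabloid_act1 T : tabloid_act 1%g T = T.
Proof. by apply/ffunP => x; rewrite ffunE invg1 perm1. Qed.

(** [(s * t)%g] is [t \o s] in [{perm _}]. *)
Lemma tabloid_actM s t T :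
  tabloid_act (t * s)%g T = tabloid_act s (tabloid_act t T).
Proof. by apply/ffunP => x; rewrite !ffunE invMg permM. Qed.

Definition specht_act (s : {perm 'I_m}) (v : {ffun tabloid -> rat^o}) :
    {ffun tabloid -> rat^o} :=
  [ffun T => v (tabloid_act s^-1%g T)].

Lemma specht_act_linear s : linear (specht_act s).
Proof. by move=> c u v; apply/ffunP => x; rewrite !ffunE. Qed.

Lemma specht_stable mu s v : v \in specht mu -> specht_act s v \in specht mu.
Proof.
pose f := GRing.isLinear.Build _ _ _ _ (specht_act s) (specht_act_linear s).
pose F : {linear _ -> _} := HB.pack (specht_act s) f.
have -> : specht_act s v = linfun F v by rewrite lfunE.
move=> vS; have: linfun F v \in (linfun F @: specht mu)%VS by exact: memv_img.
apply/subvP; rewrite limg_span; apply/span_subvP => _ /mapP[_ /mapP[t tmu ->] ->].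
rewrite lfunE /= {F f}.
rewrite mem_enum in tmu; have /andP[/injectiveP ti /forallP tm] := tmu.
pose t' : {ffun 'I_m -> 'I_m * 'I_m} := [ffun x => t (s^-1%g x)].
have -> : specht_act s (polytabloid t) = polytabloid t'.
  apply/ffunP => T; rewrite !ffunE [RHS](reindex_inj (conjg_inj s)) /=.
  apply: eq_big => [u|u _].
    apply/forallP/forallP => h x; last first.
      by have := h (s x); rewrite !ffunE conjgE !permM !permK.
    by rewrite !ffunE conjgE !permM permK h.
  rewrite odd_permJ; congr (_ * _%:R); congr (nat_of_bool _).
  have -> : row_tabloid t' = tabloid_act s (row_tabloid t).
    by apply/ffunP => x; rewrite !ffunE.
  rewrite -tabloid_actM conjgE !mulgA mulgV mul1g tabloid_actM.
  apply/eqP/eqP => [->|<-]; rewrite -tabloid_actM.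
    by rewrite mulVg tabloid_act1.
  by rewrite mulgV tabloid_act1.
apply: memv_span; apply: map_f; rewrite mem_enum; apply/andP; split.
  by apply/injectiveP => x y; rewrite !ffunE => /ti/perm_inj.
by apply/forallP => x; rewrite ffunE.
Qed.

End Specht.

Record wreath (m n : nat) := Wreath {
  wr_base : {ffun 'I_n -> {perm 'I_m}};
  wr_top : {perm 'I_n} }.

Section Wreath.
Variables m n : nat.
Local Notation G := (wreath m n).

Definition wr_pair (g : G) := (wr_base g, wr_top g).
Definition pair_wr (p : {ffun 'I_n -> {perm 'I_m}} * {perm 'I_n}) : G :=
  Wreath p.1 p.2.
Fact wr_pairK : cancel wr_pair pair_wr. Proof. by case. Qed.
HB.instance Definition _ := Finite.copy G (can_type wr_pairK).

(** As products in [{perm _}] compose from left to right, [wr_mul] is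
    [(s; p) (s'; p') = (t; p \o p')] with [t i = s i \o s' (p^-1 i)]. *)
Definition wr_mul (g h : G) : G :=
  Wreath [ffun i => wr_base h ((wr_top g)^-1%g i) * wr_base g i]%g
         (wr_top h * wr_top g)%g.
Definition wr_one : G := Wreath [ffun=> 1%g] 1%g.
Definition wr_inv (g : G) : G :=
  Wreath [ffun i => (wr_base g (wr_top g i))^-1]%g (wr_top g)^-1%g.

Fact wr_eq (g h : G) :
  wr_base g =1 wr_base h -> wr_top g = wr_top h -> g = h.
Proof. by case: g h => [s p] [t q] /= /ffunP-> ->. Qed.

Fact wr_mulA : associative wr_mul.
Proof.
move=> g h k; apply: wr_eq => [i|] /=; last by rewrite mulgA.
by rewrite !ffunE invMg permM !mulgA.
Qed.

Fact wr_mul1 : left_id wr_one wr_mul.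
Proof.
move=> g; apply: wr_eq => [i|] /=; last by rewrite mulg1.
by rewrite !ffunE invg1 perm1 mulg1.
Qed.

Fact wr_mulV : left_inverse wr_one wr_inv wr_mul.
Proof.
move=> g; apply: wr_eq => [i|] /=; last by rewrite mulgV.
by rewrite !ffunE invgK mulgV.
Qed.

HB.instance Definition _ := Finite_isGroup.Build G wr_mulA wr_mul1 wr_mulV.

Lemma wr_mulE (g h : G) : (g * h)%g = wr_mul g h. Proof. by []. Qed.
Lemma wr_oneE : 1%g = wr_one. Proof. by []. Qed.

(** The action on [n]-tuples with entries in a set [X] with a left action [a]
    of ['S_m]. *)
Definition wr_act (X : Type) (a : {perm 'I_m} -> X -> X) (g : G)
    (x : {ffun 'I_n -> X}) : {ffun 'I_n -> X} :=
  [ffun i => a (wr_base g i) (x ((wr_top g)^-1%g i))].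

Section Action.
Variables (X : Type) (a : {perm 'I_m} -> X -> X).
Hypotheses (a1 : forall x, a 1%g x = x)
           (aM : forall s t x, a (t * s)%g x = a s (a t x)).

Fact wr_act1 x : wr_act a 1%g x = x.
Proof. by apply/ffunP => i; rewrite wr_oneE !ffunE invg1 perm1 a1. Qed.

Fact wr_actM g h x : wr_act a (g * h)%g x = wr_act a g (wr_act a h x).
Proof. by apply/ffunP => i; rewrite wr_mulE !ffunE /= invMg permM aM. Qed.

End Action.

(** The subgroup of the [(s; p)] with [p] in the Young subgroup
    [S_(n-k) * S_k], which preserves the first [n - k] indices. *)
Definition wr_young_set (k : nat) : {set G} :=
  [set g : G | [forall i, (wr_top g i < n - k)%N == (i < n - k)%N]]%SET.

Fact wr_young_group_set k : group_set (wr_young_set k).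
Proof.
apply/group_setP; split=> [|g h].
  by rewrite inE; apply/forallP => i; rewrite wr_oneE perm1.
rewrite !inE => /forallP hg /forallP hh; apply/forallP => i.
by rewrite wr_mulE permM (eqP (hg _)) hh.
Qed.

Canonical wr_young k : {group G} := Group (wr_young_group_set k).

(** [v_1 (x) ... (x) v_n], with the [n]-fold tensor power of the functions on
    [X] identified with the functions on [X^n]. *)
Definition pure_tensor (X : finType) (v : 'I_n -> {ffun X -> rat^o}) :
    {ffun {ffun 'I_n -> X} -> rat^o} :=
  [ffun x : {ffun 'I_n -> X} => \prod_i (v i (x i) : rat)].

Definition tensor_space (X : finType) (U : 'I_n -> {vspace {ffun X -> rat^o}}) :
    {vspace {ffun {ffun 'I_n -> X} -> rat^o}} :=
  span_set [set u | exists2 v, forall i, v i \in U i & u = pure_tensor v]%classic.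

Definition tabloid_mod : gmodule G :=
  perm_mod (wr_act1 (@tabloid_act1 m)) (wr_actM (@tabloid_actM m)).

Lemma tabloid_mod_pure (g : G) (v : 'I_n -> {ffun tabloid m -> rat^o}) :
  @gm_act _ tabloid_mod g (pure_tensor v) =
  pure_tensor (fun i => specht_act (wr_base g i) (v ((wr_top g)^-1%g i))).
Proof.
apply/ffunP => x; rewrite !ffunE (reindex_inj (@perm_inj _ (wr_top g)^-1%g)) /=.
by apply: eq_bigr => i _; rewrite !ffunE invgK permKV.
Qed.

Definition shape (k : nat) (i : 'I_n) : seq nat :=
  if (i < n - k)%N then [:: m] else [:: m.-1; 1%N].

Definition base_space (k : nat) :=
  tensor_space (fun i => specht m (shape k i)).

Fact base_stable k : @submodule _ (res_mod (wr_young k) tabloid_mod) (base_space k).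
Proof.
move=> h u /mem_span_set[s [sA]].
pose f := GRing.isLinear.Build _ _ _ _ _ (@gm_linear _ tabloid_mod (sgval h)).
pose F : {linear _ -> _} := HB.pack (@gm_act _ tabloid_mod (sgval h)) f.
have -> : gm_act h u = linfun F u by rewrite lfunE.
move=> us; have: linfun F u \in (linfun F @: <<s>>)%VS by exact: memv_img.
apply/subvP; rewrite limg_span; apply/span_subvP => _ /mapP[x /sA[v vS ->] ->].
rewrite lfunE; apply: span_set_sub.
have -> : F (pure_tensor v) = gm_act (sgval h) (pure_tensor v : tabloid_mod) by [].
rewrite tabloid_mod_pure; eexists; last by reflexivity.
move=> i; apply: specht_stable.
have: sgval h \in wr_young k by exact: subgP.
rewrite inE => /forallP/(_ ((wr_top (sgval h))^-1%g i)); rewrite permKV => /eqP e.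
by rewrite /shape e; apply: vS.
Qed.

(** The simple module indexed by [((n-k), (k), 0, ..., 0)]. *)
Definition wreath_simple (k : nat) : gmodule G := ind_mod (submod (@base_stable k)).

End Wreath.

Section Voting.
Variables m n : nat.

Definition committee : finType := {ffun 'I_n -> 'I_m}.

(** A full ranking is given by the position of each committee, the most
    preferred one having position [0]. *)
Definition ranking : finType :=
  {F : {ffun committee -> 'I_(m ^ n)} | injectiveb F}.

Definition profile : vectType rat := {ffun ranking -> rat^o}.
Definition results : vectType rat := {ffun committee -> rat^o}.
Definition weighting : vectType rat := 'rV[rat]_(m ^ n).

Fact committee_act1 (x : 'I_m) : (1%g : {perm 'I_m}) x = x.
Proof. exact: perm1. Qed.

Fact committee_actM (s t : {perm 'I_m}) (x : 'I_m) : (t * s)%g x = s (t x).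
Proof. exact: permM. Qed.

Definition results_mod : gmodule (wreath m n) :=
  perm_mod (wr_act1 (a := fun s : {perm 'I_m} => s) committee_act1)
           (wr_actM (a := fun s : {perm 'I_m} => s) committee_actM).

Definition positional (w : weighting) (p : profile) : results :=
  [ffun c => \sum_(F : ranking) p F * w 0 (val F c)].

Definition lex_lt (c d : committee) : bool :=
  [exists i : 'I_n, (c i < d i)%N &&
    [forall i' : 'I_n, (i' < i)%N ==> (c i' == d i')]].

Fact lex_position_subproof (c : committee) : (#|[pred d | lex_lt d c]| < m ^ n)%N.
Proof.
have -> : (m ^ n = #|committee|)%N by rewrite card_ffun !card_ord.
apply: (@proper_card _ [pred d | lex_lt d c] predT); apply/properP; split.
  exact/fintype.subsetP.
by exists c => //; rewrite inE; apply/existsP => -[i]; rewrite ltnn.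
Qed.

Definition lex_position (c : committee) : 'I_(m ^ n) :=
  Ordinal (lex_position_subproof c).

(** The identification of weighting vectors with results vectors. *)
Definition weighting_result (w : weighting) : results :=
  [ffun c => w 0 (lex_position c)].

Definition Proj (k : nat) : 'End(results_mod) :=
  isotypic_proj results_mod (wreath_simple m n k).

End Voting.

Arguments Proj : clear implicits.

(* Main.v *)
(** All rankings of the [N = m ^ n] committees are available, so only the
    symmetric group on the committees matters, and the projections are used only
    to see that the [w i] are linearly independent. Averaging [u (F d) * v (F c)]
    over the rankings [F], with [u] sum-zero, gives a multiple of
    [(u, v) * ((c == d) - 1 / N)]. Take [v = a_k] dual to the [w i]: the profile
    [F |-> \sum_k \sum_c r k c * a_k (F c)] is then sent by each [w i] to a
    fixed nonzero multiple of [r i]. Taking [v] constant puts the constant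
    profiles in every kernel, which yields infinitely many solutions. *)
From HB Require Import structures.
Require Import Defs.
From mathcomp Require Import all_boot all_order all_fingroup all_algebra.
From mathcomp Require Import mathcomp_extra boolp classical_sets functions cardinality.
Import GRing.Theory Num.Theory.
Local Open Scope ring_scope.

Section Rankings.
Variables m n : nat.
Local Notation N := (m ^ n)%N.
Local Notation C := (committee m n).
Local Notation L := (#|ranking m n|).

Lemma card_committee : #|C| = N.
Proof. by rewrite card_ffun !card_ord. Qed.

Lemma ranking_inj (F : ranking m n) : injective (val F).
Proof. exact/injectiveP/(valP F). Qed.

Definition Ranking (f : {ffun C -> 'I_N}) (fi : injectiveb f) : ranking m n :=
  exist (fun f : {ffun C -> 'I_N} => is_true (injectiveb f)) f fi.

Lemma card_ranking_gt0 : (0 < L)%N.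
Proof.
pose f : {ffun C -> 'I_N} := [ffun c => cast_ord card_committee (enum_rank c)].
suff fi : injectiveb f by apply/card_gt0P; exists (Ranking f fi).
by apply/injectiveP => c d; rewrite !ffunE => /cast_ord_inj/enum_rank_inj.
Qed.

Lemma sum_positions (F : ranking m n) (f : 'I_N -> rat) :
  \sum_c f (val F c) = \sum_s f s.
Proof.
rewrite [RHS](reindex (val F)) //; apply: onW_bij.
apply: inj_card_bij; first exact: ranking_inj.
by rewrite card_committee card_ord.
Qed.

Section Relabel.
Variable s : {perm C}.

Fact relabel_subproof (F : ranking m n) : injectiveb [ffun c => val F (s c)].
Proof. by apply/injectiveP => c d; rewrite !ffunE => /ranking_inj/perm_inj. Qed.

Definition relabel (F : ranking m n) : ranking m n := Ranking _ (relabel_subproof F).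

Lemma relabelE F c : val (relabel F) c = val F (s c).
Proof. by rewrite /= ffunE. Qed.

Lemma relabel_inj : injective relabel.
Proof.
move=> F G FG; apply/val_inj/ffunP => c.
by rewrite -(permKV s c) -!relabelE FG.
Qed.

End Relabel.

Section Correlation.
Variables u v : 'I_N -> rat.
Hypothesis u0 : \sum_s u s = 0.

(** The entry at [d] of the positional map of [u] applied to the profile [F |-> v (F c)]. *)
Definition correlation (d c : C) : rat :=
  \sum_(F : ranking m n) u (val F d) * v (val F c).

(** Relabelling the committees permutes the rankings. Hence [correlation d c] depends only on
    whether [d = c]. *)
Lemma correlation_perm (s : {perm C}) d c :
  correlation (s d) (s c) = correlation d c.
Proof.
rewrite /correlation [RHS](reindex_inj (relabel_inj s)).
by apply: eq_bigr => F _; rewrite !relabelE.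
Qed.

(** All [N] diagonal values agree, and in their total each ranking runs once through all
    positions. *)
Lemma correlation_diag c : N%:R * correlation c c = L%:R * \sum_s u s * v s.
Proof.
have -> : N%:R * correlation c c = \sum_d correlation d d.
  rewrite (eq_bigr (fun=> correlation c c)) => [|d _].
    by rewrite sumr_const -[RHS]mulr_natl card_committee.
  by rewrite -{1 2}(tpermL c d) correlation_perm.
rewrite exchange_big /= (eq_bigr (fun=> \sum_s u s * v s)) => [|F _].
  by rewrite sumr_const -[LHS]mulr_natl.
exact: sum_positions (fun s => u s * v s).
Qed.

(** For fixed [c] the values sum to zero over the first argument because [u] is sum-zero, and the
    [N.-1] off-diagonal ones are equal. *)
Lemma correlation_offdiag d c : d != c ->
  N.-1%:R * correlation d c = - correlation c c.
Proof.
move=> dc; apply/eqP; rewrite -addr_eq0; apply/eqP.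
have : \sum_e correlation e c = 0.
  rewrite exchange_big big1 // => F _.
  by rewrite -mulr_suml (sum_positions F) u0 mul0r.
rewrite (bigD1 c) //= addrC => <-; congr (_ + _).
rewrite (eq_bigr (fun=> correlation d c)) => [|e ec].
  by rewrite sumr_const -[RHS]mulr_natl cardC1 card_committee.
(* The transposition of [d] and [e] fixes [c], as both differ from it. *)
by rewrite -(correlation_perm (tperm d e)) tpermR tpermD // eq_sym.
Qed.

(** The first factor on the right is the matrix of the projection onto sum-zero results vectors. The
    factor [N.-1] stays on the left since it vanishes when there is a single committee. *)
Lemma correlationE d c : (0 < N)%N ->
  N.-1%:R * correlation d c =
  ((c == d)%:R - N%:R^-1) * (L%:R * \sum_s u s * v s).
Proof.
move=> N_gt0.
have N0 : N%:R != 0 :> rat by rewrite pnatr_eq0 -lt0n.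
have NP : N.-1%:R = N%:R - 1 :> rat by rewrite -{2}(prednK N_gt0) -natr1 addrK.
rewrite -(correlation_diag c); case: eqVneq => [->|cd].
  by rewrite NP !mulrBl mulKf // !mul1r.
by rewrite correlation_offdiag 1?eq_sym // sub0r mulNr mulKf.
Qed.

End Correlation.

(** Duality kills the terms with [k != i]; in the remaining one the [1 / N] part drops out because
    [r i] sums to zero. *)
Lemma sum_dual_correlation j (w a : 'I_j -> 'I_N -> rat)
    (r : 'I_j -> results m n) i d :
  (0 < N)%N -> (forall k, \sum_s w k s = 0) ->
  (forall k l, \sum_s w k s * a l s = (k == l)%:R) ->
  \sum_c r i c = 0 ->
  N.-1%:R * (\sum_k \sum_c r k c * correlation (w i) (a k) d c) = L%:R * r i d.
Proof.
move=> N_gt0 w0 wa ri0; rewrite mulr_sumr.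
under eq_bigr => k _.
  rewrite mulr_sumr; under eq_bigr => c _ do rewrite mulrCA correlationE // wa.
  over.
rewrite (bigD1 i) //= [X in _ + X]big1 ?addr0 => [|k ki]; last first.
  by rewrite big1 // => c _; rewrite [i == k]eq_sym (negPf ki) !mulr0.
rewrite eqxx mulr1.
under eq_bigr => c _ do rewrite mulrA mulrBr.
rewrite -mulr_suml sumrB -mulr_suml ri0 mul0r subr0 mulrC; congr (_ * _).
rewrite (bigD1 d) //= eqxx mulr1 big1 ?addr0 // => c cd.
by rewrite (negPf cd) mulr0.
Qed.

Lemma weighting_result_linear : linear (@weighting_result m n).
Proof. by move=> c u v; apply/ffunP => x; rewrite !ffunE !mxE. Qed.

HB.instance Definition _ :=
  GRing.isLinear.Build _ _ _ _ (@weighting_result m n) weighting_result_linear.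

End Rankings.

(** A linear map carries any relation among the rows to the same relation among their images. *)
Lemma free_row_free {K : fieldType} {V : vectType K} {j N} (f : {linear 'rV[K]_N -> V})
    (w : 'I_j -> 'rV[K]_N) :
  free [seq f (w i) | i <- enum 'I_j] -> row_free (\matrix_i w i).
Proof.
move=> wf; apply: inj_row_free => v /(congr1 f); rewrite mulmx_sum_row !linear_sum.
have /freeP wf' : free [tuple f (w i) | i < j] by [].
rewrite linear0 => v0; apply/rowP => i; rewrite mxE; apply: wf' => {i}.
rewrite -[RHS]v0; apply: eq_bigr => i _.
by rewrite (nth_map i) ?size_enum_ord // nth_ord_enum linearZ rowK.
Qed.

Theorem theorem4p2 (m n j : nat) (hm : (2 <= m)%N) (hn : (2 <= n)%N)
    (hj : (1 <= j)%N)
    (w : 'I_j -> weighting m n)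
    (hw0 : forall i, \sum_s w i 0 s = 0)
    (hw : forall k, (1 <= k <= n)%N ->
      free [seq Proj m n k (weighting_result (w i)) | i <- enum 'I_j])
    (r : 'I_j -> results m n)
    (hr : forall i, \sum_(c : committee m n) r i c = 0) :
  infinite_set [set p : profile m n |
    forall i : 'I_j, positional (w i) p = r i]%classic.
Proof.
have N_gt0 : (0 < m ^ n)%N by rewrite expn_gt0 ltnW.
have P0 : (m ^ n).-1%:R != 0 :> rat.
  rewrite pnatr_eq0 -lt0n -ltnS prednK //.
  by rewrite (leq_trans hm) // -{1}(expn1 m) leq_exp2l // ltnW.
have L0 : #|ranking m n|%:R != 0 :> rat by rewrite pnatr_eq0 -lt0n card_ranking_gt0.
(* The columns of [A] are the vectors dual to the [w i]; independence of the images under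
   [Proj m n 1] provides this right inverse. *)
have [A WA] : exists A, (\matrix_i w i) *m A = 1%:M.
  apply/row_freeP.
  apply: (free_row_free (Proj m n 1 \o @weighting_result m n)).
  by apply: hw; exact: ltnW.
have wA i k : \sum_s w i 0 s * A s k = (i == k)%:R.
  move/matrixP/(_ i k): WA; rewrite !mxE => <-.
  by apply: eq_bigr => s _; rewrite mxE.
pose q : profile m n :=
  [ffun F : ranking m n => \sum_k \sum_c r k c * A (val F c) k].
have qE i d : (m ^ n).-1%:R * positional (w i) q d = #|ranking m n|%:R * r i d.
  rewrite -(sum_dual_correlation m n j (fun k s => w k 0 s) (fun k s => A s k)) //.
  congr (_ * _); rewrite ffunE; under eq_bigr => F _ do rewrite ffunE mulr_suml.
  rewrite exchange_big; apply: eq_bigr => k _.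
  under eq_bigr => F _ do rewrite mulr_suml.
  rewrite exchange_big; apply: eq_bigr => c _.
  by rewrite mulr_sumr; apply: eq_bigr => F _; rewrite mulrAC -mulrA.
(* The factor cancels the scalar in [qE]; the constant [t] yields one solution for each natural
   number. *)
pose p (t : nat) : profile m n :=
  [ffun F => (m ^ n).-1%:R / #|ranking m n|%:R * q F + t%:R].
have pE t i : positional (w i) (p t) = r i.
  apply/ffunP => d; rewrite ffunE.
  under eq_bigr => F _ do rewrite ffunE mulrDl -!mulrA.
  (* The constant part is a correlation with a constant vector, which vanishes because [w i] is
     sum-zero. *)
  rewrite big_split /= [X in _ + X](_ : _ = 0) ?addr0; last first.
    transitivity (correlation m n (fun s => w i 0 s) (fun=> t%:R) d d).
      by apply: eq_bigr => F _; rewrite mulrC.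
    by apply: (mulfI P0); rewrite correlationE // -mulr_suml hw0 mul0r !mulr0.
  by apply: (mulfI L0); rewrite -qE ffunE -!mulr_sumr mulrCA mulVKf.
have p_inj : injective p.
  (* Evaluating at some ranking recovers [t], so one must exist. *)
  have /card_gt0P[F _] := card_ranking_gt0 m n.
  by move=> t t' /ffunP/(_ F); rewrite !ffunE => /addrI/eqP; rewrite eqr_nat => /eqP.
apply/infiniteP; apply: (card_le_trans (B := (p @` setT)%classic)).
  by move: (inj_card_eq (A := setT) (in2W p_inj)); rewrite card_eq_le => /andP[].
by apply: subset_card_le => _ [t _ <-] i; exact: pE.
Qed.
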